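(* Consider the absolute loss $\ell(y,y')=|y-y'|$ with output space $\mathcal Y=\mathbb R$. For any training set size $n\ge1$, positive integer $d$, positive real number $b$ and input space $\mathcal X$ containing at least $\lfloor\log_2d\rfloor$ points, there exists a set $\mathcal G$ of $d$ prediction functions uniformly bounded by $b$ such that: for any estimator $\hat g$ there exists a probability distribution on $\mathcal X\times\mathbb R$ for which $\mathbb E|Y|<+\infty$ and $$\mathbb ER(\hat g)-\min_{g\in\mathcal G}R(g)\ge\frac b4\sqrt{\frac{\lfloor\log_2|\mathcal G|\rfloor}n\wedge\frac14}.$$
   Context: A prediction function is a measurable map $\mathcal X\to\mathbb R$. For a distribution $P$ on $\mathcal X\times\mathbb R$, $R(g)=\mathbb E_{(X,Y)\sim P}\ell[Y,g(X)]$. An estimator maps a training set $Z_1^n\in(\mathcal X\times\mathbb R)^n$ to a prediction function (measurably), and $\mathbb ER(\hat g)$ is its expected risk when $Z_1^n\sim P^{\otimes n}$. $a\wedge b=\min(a,b)$ and $\lfloor x\rfloor$ is the largest integer $k\le x$.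
   Formalization: The input space is nonempty, and its at least ⌊log₂ d⌋ points are required to be separated by measurable sets (automatic when singletons are measurable); with a trivial sigma-algebra the claim as worded fails for large n and d. *)

(* Defs.v *)
From HB Require Import structures.
From mathcomp Require Import all_boot all_order all_algebra.
From mathcomp Require Import finmap.
From mathcomp Require Import all_classical all_reals all_analysis.
Import Order.TTheory GRing.Theory Num.Theory.

Set Implicit Arguments.
Unset Strict Implicit.
Unset Printing Implicit Defensive.

Local Open Scope classical_set_scope.
Local Open Scope ring_scope.

(* The n-fold product measure of a probability, on the product sigma-algebra of
   n.-tuple T; it is characterised by power_probability_rect. *)
Section power_probability.
Context (disp : measure_display) (T : measurableType disp) (R : realType).

Definition tuple_cons (n : nat) (p : T * n.-tuple T) : n.+1.-tuple T :=
  [tuple of p.1 :: p.2].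

Lemma measurable_tuple_cons (n : nat) :
  measurable_fun [set: T * n.-tuple T] (@tuple_cons n).
Proof. exact: measurable_cons. Qed.

HB.instance Definition _ (n : nat) :=
  isMeasurableFun.Build _ _ _ _ (@tuple_cons n) (@measurable_tuple_cons n).

Fixpoint power_probability (P : probability T R) (n : nat) :
    probability (n.-tuple T) R :=
  match n with
  | 0 => \d_([tuple] : 0.-tuple T)
  | m.+1 => distribution (P \x power_probability P m)%E (@tuple_cons m)
  end.

Lemma measurable_rect (n : nat) (A : 'I_n -> set T) :
  (forall i, measurable (A i)) ->
  measurable [set t : n.-tuple T | forall i, A i (tnth t i)].
Proof.
move=> mA.
rewrite [X in measurable X](_ : _ =
    \bigcap_(i in [set: 'I_n]) ((@tnth n T)^~ i @^-1` A i)); last first.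
  by apply/seteqP; split => t /= tA i => [_|]; exact: tA.
apply: fin_bigcap_measurable => // i _.
rewrite -[X in measurable X]setTI; exact: measurable_tnth.
Qed.

Lemma power_probability_rect (P : probability T R) (n : nat)
    (A : 'I_n -> set T) :
  (forall i, measurable (A i)) ->
  power_probability P n [set t | forall i, A i (tnth t i)] =
  (\prod_(i < n) P (A i))%E.
Proof.
elim: n => [|n IHn] in A *; move=> mA.
  rewrite big_ord0 [LHS]diracE (_ : _ \in _ = true)//.
  by apply/mem_set => -[].
rewrite big_ord_recl /= /distribution /pushforward.
rewrite (_ : _ @^-1` _ =
    A ord0 `*` [set t | forall i, A (lift ord0 i) (tnth t i)]); last first.
  apply/seteqP; split => -[x t] /=.
    move=> H; split; first exact: (H ord0).
    by move=> i; have := H (lift ord0 i); rewrite /tuple_cons tnthS.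
  move=> [Ax At] i; have [->//|i0] := eqVneq i ord0.
  case: (unliftP ord0 i) i0 => [j ->|->]; last by rewrite eqxx.
  by move=> _; rewrite /tuple_cons tnthS; exact: At.
rewrite product_measure1E//; last first.
  exact: (@measurable_rect n (fun i => A (lift ord0 i))).
by congr (_ * _)%E; exact: (IHn (fun i => A (lift ord0 i))).
Qed.

End power_probability.

Section learning.
Context (disp : measure_display) (X : measurableType disp) (R : realType).

(* At least k points; X carries an arbitrary sigma-algebra, hence the points are
   also required to be told apart by it. Nothing more than #|X| >= k is asked
   when singletons are measurable, see contains_points_card. *)
Definition contains_points (k : nat) : Prop :=
  exists x : 'I_k -> X,
    injective x /\
    forall i j, i != j -> exists A, [/\ measurable A, A (x i) & ~ A (x j)].

Lemma contains_points_card (k : nat) :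
  (forall x : X, measurable [set x]) ->
  (exists x : 'I_k -> X, injective x) -> contains_points k.
Proof.
move=> mX [x xI]; exists x; split => // i j ij; exists [set x i]; split => //=.
by move=> /xI/eqP; rewrite eq_sym (negbTE ij).
Qed.

Definition absolute_loss (y y' : R) : R := `|y - y'|.

Definition risk (l : R -> R -> R) (P : probability (X * R)%type R)
    (g : X -> R) : \bar R :=
  (\int[P]_z (l z.2 (g z.1))%:E)%E.

Definition is_estimator (n : nat) (ghat : n.-tuple (X * R) -> X -> R) : Prop :=
  measurable_fun [set: n.-tuple (X * R) * X] (fun p => ghat p.1 p.2).

Definition expected_risk (l : R -> R -> R) (P : probability (X * R)%type R)
    (n : nat) (ghat : n.-tuple (X * R) -> X -> R) : \bar R :=
  (\int[power_probability P n]_s risk l P (ghat s))%E.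

End learning.
Arguments contains_points {disp} X k.

Lemma floor_log2E (R : realType) (m : nat) : (0 < m)%N ->
  Num.floor (ln (m%:R : R) / ln 2) = (trunc_log 2 m)%:Z.
Proof.
move=> m0; have ln2 : 0 < ln (2 : R) by rewrite ln_gt0// ltr1n.
have /andP[lb ub] := @trunc_log_bounds 2 m isT m0.
apply: floor_def.
rewrite -PoszD addn1 -!pmulrn ler_pdivlMr// ltr_pdivrMr// !mulr_natl -!lnXn//.
rewrite -!natrX ler_ln ?ltr_ln ?posrE ?ltr0n ?expn_gt0//.
by rewrite ler_nat ltr_nat lb.
Qed.

(* Main.v *)
(* Assouad's lemma. Put mass 1/m on each of m separated points, and let the
   label at x_j be b or - b, the value chosen by bit j of the target s being
   favoured by a bias xi. The risk of a predictor exceeds that of the vertex g_s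
   by an average over j of nonnegative terms, and for two targets that differ in
   bit j only, the two j-th terms sum to at least 2 b xi; so the average over the
   cube of the excess risk is at least b xi times the overlap (the sum of the
   pointwise minimum) of the two laws of the sample. With
   xi = (1/2) sqrt(min(m/n, 1/4)) that overlap is at least 1/2 by a Hellinger
   affinity estimate, which gives b xi / 2. Bounding the total variation by the
   KL or chi-square divergence would narrowly miss the constant 1/4. *)
Require Import Defs.
From HB Require Import structures.
From mathcomp Require Import all_boot all_order all_algebra.
From mathcomp Require Import finmap.
From mathcomp Require Import all_classical all_reals all_analysis.
From mathcomp Require Import measurable_realfun ring lra.
Import Order.TTheory GRing.Theory Num.Theory.
Local Open Scope classical_set_scope.
Local Open Scope ring_scope.

(** * Finitely supported probabilities *)

Section finite_support.
Context {disp : measure_display} {T : measurableType disp} {R : realType}.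
Context {I : finType} (w : I -> R) (z : I -> T).
Context (w_ge0 : forall i, 0 <= w i).

(** The witness is the weighted sum of Dirac masses at the points [z i]. Only its integration
    formula is exported, since every risk below is the integral of a nonnegative function. *)
Lemma finite_support_probability : \sum_i w i = 1 ->
  exists P : probability T R, forall f : T -> \bar R,
    measurable_fun [set: T] f -> (forall x, 0 <= f x)%E ->
    (\int[P]_x f x = \sum_i (w i)%:E * f (z i))%E.
Proof.
(* [i0] is the default value of [nth] in the enumeration of [I]; an empty [I] would make the weights
   sum to 0. *)
move=> w1; have [i0 _|I0] := pickP (xpredT : pred I); last first.
  by move/eqP: w1; rewrite big_pred0// eq_sym oner_eq0.
pose c k : {nonneg R} := NngNum (w_ge0 (nth i0 (enum I) k)).
pose mu : nat -> measure T R :=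
  fun k => mscale (c k) (\d_(z (nth i0 (enum I) k)) : measure T R).
have muE f : measurable_fun [set: T] f -> (forall x, 0 <= f x)%E ->
    (\int[msum mu #|I|]_x f x = \sum_i (w i)%:E * f (z i))%E.
  move=> mf f0; rewrite ge0_integral_measure_sum//.
  transitivity (\sum_(k < #|I|) (w (nth i0 (enum I) k))%:E *
      f (z (nth i0 (enum I) k)))%E.
    apply: eq_bigr => k _.
    by rewrite ge0_integral_mscale// integral_dirac// diracT mul1e.
  rewrite [RHS]big_enum_val; apply: eq_bigr => k _.
  by rewrite (enum_val_nth i0).
have mu1 : msum mu #|I| [set: T] = 1%E.
  rewrite -[LHS]mul1e -integral_cst// muE//.
  under eq_bigr do rewrite mule1.
  by rewrite sumEFin w1.
pose P_build := Measure_isProbability.Build _ _ _ (msum mu #|I|) mu1.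
pose P : probability T R := HB.pack (msum mu #|I|) P_build.
by exists P => f mf f0; rewrite -muE.
Qed.

Lemma big_tuple_consE {U : Type} {idx : U} {op : Monoid.com_law idx} (n : nat)
    (F : n.+1.-tuple I -> U) :
  \big[op/idx]_t F t =
  \big[op/idx]_i \big[op/idx]_(t : n.-tuple I) F [tuple of i :: t].
Proof.
rewrite pair_big (reindex (fun p : I * n.-tuple I => [tuple of p.1 :: p.2]))//=.
exists (fun t => (thead t, [tuple of behead t])) => [[i t] _|t _] /=.
  by congr pair; exact/val_inj.
by rewrite [in RHS](tuple_eta t).
Qed.

Lemma sum_prod_tuple (n : nat) (v : I -> R) :
  \sum_(t : n.-tuple I) \prod_(i < n) v (tnth t i) = (\sum_i v i) ^+ n.
Proof.
elim: n => [|n IHn].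
  rewrite expr0 (big_pred1 [tuple])/=; last first.
    by move=> t; apply/esym/eqP; exact: tuple0.
  by rewrite big_ord0.
rewrite big_tuple_consE exprS -IHn mulr_suml; apply: eq_bigr => i _.
rewrite mulr_sumr; apply: eq_bigr => t _.
rewrite big_ord_recl tnth0; congr (_ * _).
by apply: eq_bigr => k _; rewrite tnthS.
Qed.

(** Makes expectations over samples finite sums over tuples of atom indices: Tonelli peels off the
    first observation. *)
Lemma power_probability_finite_support (P : probability T R) (n : nat) :
  (forall f : T -> \bar R,
    measurable_fun [set: T] f -> (forall x, 0 <= f x)%E ->
    (\int[P]_x f x = \sum_i (w i)%:E * f (z i))%E) ->
  forall f : n.-tuple T -> \bar R,
    measurable_fun [set: n.-tuple T] f -> (forall x, 0 <= f x)%E ->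
    (\int[power_probability P n]_x f x =
     \sum_(t : n.-tuple I) (\prod_(i < n) w (tnth t i))%:E *
       f (map_tuple z t))%E.
Proof.
move=> PE; elim: n => [|n IHn] f mf f0.
  rewrite (big_pred1 [tuple])/=; last first.
    by move=> t; apply/esym/eqP; exact: tuple0.
  rewrite big_ord0 mul1e integral_dirac// diracT mul1e.
  by congr (f _); exact/val_inj.
have mfc : measurable_fun [set: T * n.-tuple T] (f \o @tuple_cons disp T n).
  exact: measurableT_comp.
rewrite /= ge0_integral_distribution//= fubini_tonelli1//.
rewrite PE; last 2 first.
- exact: measurable_fun_fubini_tonelli_F.
- by move=> x; exact: integral_ge0.
rewrite big_tuple_consE; apply: eq_bigr => i _.
rewrite /fubini_F IHn//; last first.
  exact: (measurableT_comp mfc (pair1_measurable _)).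
rewrite ge0_sume_distrr; last first.
  by move=> t _; rewrite mule_ge0// lee_fin prodr_ge0.
apply: eq_bigr => t _; rewrite muleA -EFinM big_ord_recl tnth0.
congr ((_ * _)%:E * f _)%E.
  by apply: eq_bigr => k _; rewrite tnthS.
exact/val_inj.
Qed.

End finite_support.

(** * Hellinger bound on the overlap of two distributions *)

Lemma bernoulli_ineq {R : realDomainType} (x : R) (n : nat) :
  0 <= x <= 1 -> 1 - x *+ n <= (1 - x) ^+ n.
Proof.
move=> /andP[x0 x1]; elim: n => [|n IHn]; first by rewrite mulr0n subr0 expr0.
have y1 : 0 <= 1 - x by rewrite subr_ge0.
rewrite exprS mulrS; apply: (le_trans _ (ler_wpM2l y1 IHn)).
have : 0 <= x * (x *+ n) by rewrite mulr_ge0// mulrn_wge0.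
by move: (x *+ n) => k; lra.
Qed.

(* [4 (7/8) (2/7) = 1], so this is AM-GM for [7/8 min] and [2/7 max]. It is
   tight at [max / min = 49/16], close to the ratio [3] of the critical case
   where the minima sum to [1/2] and the maxima to [3/2]. *)
Lemma geometric_mean_le {R : realFieldType} (h p q : R) :
  0 <= p -> 0 <= q -> h ^+ 2 <= p * q ->
  h <= 7 / 8 * Num.min p q + 2 / 7 * Num.max p q.
Proof.
wlog pq : p q / p <= q => [H p0 q0 hpq|p0 q0 hpq].
  case/orP: (le_total p q) => [/H|]; first exact.
  by rewrite minC maxC => /H; apply => //; rewrite mulrC.
rewrite min_l// max_r//.
have [//|h_gt] := leP h _.
have : (7 / 8 * p + 2 / 7 * q) ^+ 2 < h ^+ 2.
  by rewrite ltr_pXn2r// ?nnegrE; lra.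
have : 0 <= (7 / 8 * p - 2 / 7 * q) ^+ 2 by exact: sqr_ge0.
by move=> *; nra.
Qed.

(** The minima and the maxima sum to 2 together. With M the sum of the minima, summing the pointwise
    bound gives 223/256 <= 4/7 + (33/56) M, hence M >= 537/1056, just above 1/2. *)
Lemma overlap_ge_half {R : realFieldType} {T : finType} (p q h : T -> R) :
  (forall t, 0 <= p t) -> (forall t, 0 <= q t) ->
  (forall t, h t ^+ 2 <= p t * q t) ->
  \sum_t p t = 1 -> \sum_t q t = 1 -> 223 / 256 <= \sum_t h t ->
  1 / 2 <= \sum_t Num.min (p t) (q t).
Proof.
move=> p0 q0 hpq p1 q1 h1.
have : \sum_t h t <=
    7 / 8 * \sum_t Num.min (p t) (q t) + 2 / 7 * \sum_t Num.max (p t) (q t).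
  rewrite !mulr_sumr -big_split/=; apply: ler_sum => t _.
  exact: geometric_mean_le.
have : \sum_t Num.min (p t) (q t) + \sum_t Num.max (p t) (q t) = 2.
  rewrite -big_split/= -[2]/(1 + 1) -[in X in X + _]p1 -q1 -big_split/=.
  by apply: eq_bigr => t _; rewrite addr_min_max.
lra.
Qed.

(** * The hypercube of distributions *)

Section hypercube.
Context {R : realType} {m : nat}.
Implicit Types (s : {ffun 'I_m -> bool}) (xi b : R).

Definition label b (y : bool) : R := if y then b else - b.

(* The weight of [(x_j, label b y)] under the distribution with target [s]. *)
Definition cube_weight xi s (p : 'I_m * bool) : R :=
  m%:R^-1 * ((1 + (if p.2 == s p.1 then xi else - xi)) / 2).

Definition flip s (j : 'I_m) : {ffun 'I_m -> bool} :=
  [ffun k => s k (+) (k == j)].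

(* Conditional excess absolute risk of predicting [t] at a point where the label
   [label b y] is favoured: [b (1 - xi)] is the conditional risk of [label b y]. *)
Definition excess b xi (y : bool) (t : R) : R :=
  (1 + xi) / 2 * `|label b y - t| + (1 - xi) / 2 * `|label b (~~ y) - t| -
  b * (1 - xi).

Lemma flipK j : involutive (flip^~ j).
Proof. by move=> s; apply/ffunP => k; rewrite !ffunE -addbA addbb addbF. Qed.

Lemma cube_weight_ge0 xi s p : 0 <= xi <= 1 -> 0 <= cube_weight xi s p.
Proof.
move=> /andP[xi0 xi1]; rewrite mulr_ge0 ?invr_ge0//.
by case: ifP => _; lra.
Qed.

Lemma sum_cube (F : 'I_m * bool -> R) :
  \sum_p F p = \sum_j (F (j, true) + F (j, false)).
Proof.
transitivity (\sum_j \sum_y F (j, y)).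
  by rewrite pair_big; apply: eq_bigr => -[].
by apply: eq_bigr => j _; rewrite big_bool.
Qed.

Lemma sum_cube_weight xi s : (0 < m)%N -> \sum_p cube_weight xi s p = 1.
Proof.
move=> m0; rewrite sum_cube.
rewrite (eq_bigr (fun=> m%:R^-1)) => [|j _].
  by rewrite sumr_const card_ord -[_ *+ _]mulr_natr mulVf// pnatr_eq0 -lt0n.
by rewrite /cube_weight/=; case: (s j) => /=; field; rewrite pnatr_eq0 -lt0n.
Qed.

(** The excess risk decouples into one term per bit of [s], as Assouad's argument requires; the
    constant is the risk of the vertex, the same for all [s]. *)
Lemma cube_riskE b xi s (f : 'I_m -> R) : (0 < m)%N ->
  \sum_p cube_weight xi s p * `|label b p.2 - f p.1| =
  b * (1 - xi) + \sum_j m%:R^-1 * excess b xi (s j) (f j).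
Proof.
move=> m0; rewrite sum_cube.
have -> : b * (1 - xi) = \sum_(j < m) m%:R^-1 * (b * (1 - xi)).
  rewrite sumr_const card_ord -[RHS]mulr_natl mulrA divff ?mul1r//.
  by rewrite pnatr_eq0 -lt0n.
rewrite -big_split/=; apply: eq_bigr => j _.
rewrite /cube_weight /excess/= -mulrDr.
by case: (s j) => /=; field; rewrite pnatr_eq0 -lt0n.
Qed.

Lemma label_triangle b y t : 2 * b <= `|label b y - t| + `|label b (~~ y) - t|.
Proof.
have := ler_norm (b - t); have := ler_norm (- (- b - t)); rewrite normrN.
by case: y => /=; lra.
Qed.

(** The conditional risk is [(1 - xi) / 2] times the sum of the distances to both labels, which is
    at least [2 * b], plus [xi] times the distance to the favoured one. *)
Lemma excess_ge0 b xi y t : 0 <= xi <= 1 -> 0 <= excess b xi y t.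
Proof.
move=> /andP[xi0 xi1]; have := label_triangle b y t.
rewrite /excess; have := normr_ge0 (label b y - t).
by move: `|_ - t| `|_ - t| => u v u0 uv; nra.
Qed.

Lemma excess_label b xi y : 0 <= b -> excess b xi y (label b y) = 0.
Proof.
move=> b0; rewrite /excess /label; case: y => /=.
  by rewrite subrr normr0 -opprD normrN ger0_norm; lra.
by rewrite subrr normr0 opprK ger0_norm; lra.
Qed.

(** The biases cancel: the two conditional risks add up to the sum of the distances to both labels,
    at least [2 * b]. *)
Lemma excess_add_ge b xi y t :
  2 * xi * b <= excess b xi y t + excess b xi (~~ y) t.
Proof.
have := label_triangle b y t.
by rewrite /excess negbK; lra.
Qed.

(* A minorant of the geometric mean of the weights of [s] and [flip s j], free of
   square roots: [(1 - 33/64 xi^2)^2 <= 1 - xi^2] as soon as [xi <= 1/4]. *)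
Definition cube_affinity xi s j (p : 'I_m * bool) : R :=
  if p.1 == j then m%:R^-1 * ((1 - 33 / 64 * xi ^+ 2) / 2)
  else cube_weight xi s p.

Lemma sum_cube_affinity xi s j :
  \sum_p cube_affinity xi s j p = 1 - 33 / 64 * xi ^+ 2 / m%:R.
Proof.
have m0 : m%:R != 0 :> R.
  by rewrite pnatr_eq0 -lt0n (leq_ltn_trans _ (ltn_ord j)).
rewrite sum_cube (bigD1 j)//= /cube_affinity/= eqxx.
rewrite (eq_bigr (fun=> m%:R^-1)) => [|k kj].
  rewrite sumr_const cardC1 card_ord -subn1 -(mulr_natr m%:R^-1) natrB.
    by field.
  exact: leq_ltn_trans (ltn_ord j).
by rewrite (negPf kj) /cube_weight/=; case: (s k) => /=; field.
Qed.

Lemma sqr_cube_affinity xi s j p : 0 <= xi <= 1 / 4 ->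
  cube_affinity xi s j p ^+ 2 <=
  cube_weight xi s p * cube_weight xi (flip s j) p.
Proof.
move=> /andP[xi0 xi1]; rewrite /cube_affinity /cube_weight /flip ffunE.
case: p => k y /=; have [->|kj] := eqVneq k j; last first.
  by rewrite addbF expr2.
rewrite expr2 [leLHS]mulrACA [leRHS]mulrACA ler_wpM2l ?mulr_ge0 ?invr_ge0//.
have xi2 : 0 <= xi ^+ 2 <= 1 / 16 by rewrite sqr_ge0/=; nra.
by case: (s j) y => -[] /=; nra.
Qed.

(** Affinities multiply over independent observations, so Bernoulli's inequality bounds the affinity
    of the samples below by 1 - (33/64) xi^2 n/m >= 1 - 33/256 = 223/256. *)
Lemma overlap_cube xi s j n : 0 <= xi <= 1 / 4 -> xi ^+ 2 * n%:R <= m%:R / 4 ->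
  1 / 2 <= \sum_(t : n.-tuple ('I_m * bool))
    Num.min (\prod_(i < n) cube_weight xi s (tnth t i))
            (\prod_(i < n) cube_weight xi (flip s j) (tnth t i)).
Proof.
move=> xi4 xin; have /andP[xi0 xi_le] := xi4.
have xi1 : 0 <= xi <= 1 by rewrite xi0; lra.
have m0 : (0 < m)%N by exact: leq_ltn_trans (ltn_ord j).
have mR0 : 0 < m%:R :> R by rewrite ltr0n.
have mR1 : 1 <= m%:R :> R by rewrite ler1n.
apply: (@overlap_ge_half _ _ _ _
  (fun t => \prod_(i < n) cube_affinity xi s j (tnth t i))).
- by move=> t; apply: prodr_ge0 => i _; exact: cube_weight_ge0.
- by move=> t; apply: prodr_ge0 => i _; exact: cube_weight_ge0.
- move=> t; rewrite -prodrXl -big_split/=; apply: ler_prod => i _.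
  by rewrite sqr_ge0/=; exact: sqr_cube_affinity.
- by rewrite sum_prod_tuple sum_cube_weight// expr1n.
- by rewrite sum_prod_tuple sum_cube_weight// expr1n.
rewrite sum_prod_tuple sum_cube_affinity.
apply: (le_trans _ (bernoulli_ineq _ _ _)).
  rewrite -[_ / _ *+ n]mulr_natr mulrAC.
  apply: (@le_trans _ _ (1 - 33 / 256)); first lra.
  by rewrite lerD2l lerN2 ler_pdivrMr//; lra.
rewrite divr_ge0 ?mulr_ge0 ?sqr_ge0//= ler_pdivrMr//.
by have := sqr_ge0 xi; nra.
Qed.

Lemma assouad b xi n (f : n.-tuple ('I_m * bool) -> 'I_m -> R) :
  (0 < m)%N -> 0 <= b -> 0 <= xi <= 1 / 4 -> xi ^+ 2 * n%:R <= m%:R / 4 ->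
  exists s, xi * b / 2 <=
    \sum_(t : n.-tuple ('I_m * bool))
      (\prod_(i < n) cube_weight xi s (tnth t i)) *
      \sum_j m%:R^-1 * excess b xi (s j) (f t j).
Proof.
move=> m0 b0 xi4 xin; have /andP[xi0 xi_le] := xi4.
have xi1 : 0 <= xi <= 1 by rewrite xi0; lra.
pose w s (t : n.-tuple ('I_m * bool)) :=
  \prod_(i < n) cube_weight xi s (tnth t i).
have w0 s t : 0 <= w s t.
  by apply: prodr_ge0 => i _; exact: cube_weight_ge0.
pose D s j := \sum_t w s t * excess b xi (s j) (f t j).
have DD s j : xi * b <= D s j + D (flip s j) j.
  have := ler_wpM2l (_ : 0 <= 2 * xi * b) (overlap_cube xi s j n xi4 xin).
  have /[swap]/[apply] : 0 <= 2 * xi * b by rewrite !mulr_ge0.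
  rewrite [X in X <= _](_ : _ = xi * b); last by field.
  move/le_trans; apply; rewrite -big_split mulr_sumr; apply: ler_sum => t _ /=.
  rewrite -/(w s t) -/(w (flip s j) t) [flip s j j]ffunE eqxx addbT.
  have := excess_add_ge b xi (s j) (f t j).
  have := excess_ge0 b xi (s j) (f t j) xi1.
  have := excess_ge0 b xi (~~ s j) (f t j) xi1.
  move: (w0 s t) (w0 (flip s j) t).
  move: (w s t) (w (flip s j) t) (excess b xi (s j) _)
    (excess b xi (~~ s j) _) => p q e e' p0 q0 e'0 e0 ee'.
  have mn0 : 0 <= Num.min p q by rewrite le_min p0 q0.
  (* Both excesses are nonnegative, so each weight may be lowered to the minimum: p e + q e' >=
     min(p, q) (e + e'). *)
  have := ler_wpM2r mn0 ee'.
  have := ler_wpM2r e0 (_ : Num.min p q <= p).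
  have := ler_wpM2r e'0 (_ : Num.min p q <= q).
  rewrite !ge_min !lexx orbT => /(_ isT) ? /(_ isT) ?; lra.
have avg : \sum_(s : {ffun 'I_m -> bool}) xi * b / 2 <=
    \sum_s \sum_j m%:R^-1 * D s j.
  rewrite exchange_big/=.
  have H j : \sum_(s : {ffun 'I_m -> bool}) xi * b / 2 <= \sum_s D s j.
    (* Flipping bit [j] permutes the cube, so both terms of [DD] have the same sum over [s]. *)
    have : \sum_(s : {ffun 'I_m -> bool}) xi * b <= \sum_s D s j + \sum_s D s j.
      rewrite [in X in _ + X](reindex_inj (inv_inj (flipK j))) -big_split/=.
      by apply: ler_sum => s _; exact: DD.
    by move=> le2; rewrite -mulr_suml; lra.
  rewrite (_ : \sum_s _ = \sum_(j < m) m%:R^-1 *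
      \sum_(s : {ffun 'I_m -> bool}) xi * b / 2).
    by apply: ler_sum => j _; rewrite -[leRHS]mulr_sumr ler_wpM2l ?invr_ge0.
  rewrite [RHS]sumr_const card_ord -[RHS]mulr_natl mulrA divff ?mul1r//.
  by rewrite pnatr_eq0 -lt0n.
(* Some target reaches the average: otherwise summing the strict inequalities over the nonempty cube
   contradicts [avg]. *)
apply/not_existsP => H.
have : \sum_s \sum_j m%:R^-1 * D s j <
    \sum_(s : {ffun 'I_m -> bool}) xi * b / 2.
  apply: ltr_sum => [|s _]; last first.
    have /negP := H s; rewrite -ltNge; congr (_ < _).
    rewrite (eq_bigr (fun t =>
        \sum_j m%:R^-1 * (w s t * excess b xi (s j) (f t j)))).
      by rewrite exchange_big; apply: eq_bigr => j _; rewrite mulr_sumr.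
    by move=> t _; rewrite mulr_sumr; apply: eq_bigr => j _; rewrite mulrCA.
  by apply/hasP; exists [ffun=> true] => //; rewrite mem_index_enum.
by rewrite ltNge avg.
Qed.

End hypercube.

(** * The class of predictors and its minimax risk *)

(** The predictor is [b] on a measurable set [S] and [- b] off it, where [S] contains exactly the
    points whose bit is set. Its modulus is constant, which later tells it apart from the padding
    functions. *)
Lemma separated_points_label {R : realType} {disp : measure_display}
    {X : measurableType disp} {m : nat} (x : 'I_m -> X) (b : R)
    (s : {ffun 'I_m -> bool}) :
  (forall i j, i != j -> exists A, [/\ measurable A, A (x i) & ~ A (x j)]) ->
  exists g : {mfun X >-> R},
    (forall j, g (x j) = label b (s j)) /\ forall y, `|g y| = `|b|.
Proof.
move=> sep.
have {}sep i j : exists A,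
    i != j -> [/\ measurable A, A (x i) & ~ A (x j)].
  have [_|/sep[A HA]] := eqVneq i j; first by exists set0.
  by exists A.
have /choice[A HA] i : exists Ai : 'I_m -> set X, forall j, i != j ->
    [/\ measurable (Ai j), Ai j (x i) & ~ Ai j (x j)].
  by have [Ai HAi] := choice (sep i); exists Ai.
(* [B i] isolates [x i] from all the other points at once. *)
pose B i := \bigcap_(j in [set j | i != j]) A i j.
have mB i : measurable (B i).
  by apply: fin_bigcap_measurable => [|j /HA[]//]; exact: finite_finset.
have Bx i : B i (x i) by move=> j /HA[].
have BxN i j : i != j -> ~ B i (x j).
  by move=> ij /(_ j ij); case: (HA i j ij).
pose S := \bigcup_(i in [set i | s i]) B i.
have mS : measurable S.
  by apply: fin_bigcup_measurable => //; exact: finite_finset.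
have mg : measurable_fun [set: X] (fun y => 2 * b * \1_S y - b).
  by apply: measurable_funB => //; apply: measurable_funM => //;
    exact: measurable_indic.
exists (mfun_Sub (mem_set mg)); split => [j|y]; rewrite mfun_valP.
  rewrite indicE /label; case: ifPn => sj.
    by rewrite mem_set ?mulr1 ?[2 * b]mulr_natl ?mulr2n ?addrK//; exists j.
  rewrite memNset ?mulr0 ?sub0r// => -[i /= si]; apply: BxN.
  by apply: contraNneq sj => <-.
rewrite indicE; case: (y \in S).
  by rewrite mulr1 mulr_natl mulr2n addrK.
by rewrite mulr0 sub0r normrN.
Qed.

Lemma separated_points_class {R : realType} {disp : measure_display}
    {X : measurableType disp} {m : nat} (x : 'I_m -> X) (b : R) (d : nat) :
  0 < b -> (2 ^ m <= d)%N ->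
  (forall i j, i != j -> exists A, [/\ measurable A, A (x i) & ~ A (x j)]) ->
  exists G : {fset {mfun X >-> R}},
    [/\ #|` G| = d,
        forall g : {mfun X >-> R}, g \in G -> forall y, `|g y| <= b
      & forall s : {ffun 'I_m -> bool}, exists2 g : {mfun X >-> R}, g \in G &
          forall j, g (x j) = label b (s j)].
Proof.
move=> b0 md sep.
have [gs gsE] := choice (fun s => separated_points_label x b s sep).
(* These constants pad the class to exactly [d] elements when [d] is not a power of 2. The offset 2
   keeps their modulus strictly below [b], so none is a vertex. *)
pose c k : {mfun X >-> R} := cst (b / k.+2%:R).
have cE k : 0 < `|c k point| < b.
  rewrite /c/= normrM normfV !gtr0_norm// ?divr_gt0//=.
  by rewrite ltr_pdivrMr// ltr_pMr// ltr1n.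
have gs_inj : injective gs.
  move=> s s' ss'; apply/ffunP => j.
  have := (gsE s).1 j; rewrite ss' (gsE s').1 /label.
  by case: (s j) (s' j) => -[]// ?; lra.
have c_inj : injective c.
  move=> k k' /(congr1 (fun g : {mfun X >-> R} => g point)); rewrite /c/=.
  move/(mulfI (lt0r_neq0 b0))/invr_inj/eqP.
  by rewrite eqr_nat !eqSS => /eqP.
pose r := map gs (enum {ffun 'I_m -> bool}) ++ map c (iota 0 (d - 2 ^ m)).
have r_uniq : uniq r.
  rewrite cat_uniq (map_inj_uniq gs_inj) (map_inj_uniq c_inj).
  rewrite enum_uniq iota_uniq andTb andbT.
  apply/hasPn => _ /mapP[k _ ->]; apply/negP => /mapP[s _ ck].
  have /andP[_] := cE k; rewrite ck (gsE s).2 gtr0_norm//.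
  by rewrite ltxx.
have memG g : (g \in [fset g in r]%fset) = (g \in r) by rewrite in_fset.
exists [fset g in r]%fset; split.
- rewrite card_fseq (undup_id r_uniq) size_cat (size_map gs) (size_map c).
  rewrite size_iota -cardE.
  by rewrite card_ffun card_bool card_ord subnKC.
- move=> g; rewrite memG mem_cat => /orP[] /mapP[k _ ->] y.
    by rewrite (gsE k).2 gtr0_norm.
  by have /andP[_ /ltW] := cE k.
- move=> s; exists (gs s); last exact: (gsE s).1.
  by rewrite memG mem_cat map_f// mem_enum.
Qed.

(** * Risks under a hypercube distribution *)

Section cube_distribution.
Context {R : realType} {disp : measure_display} {X : measurableType disp}.
Context {m : nat} (x : 'I_m -> X) (b xi : R) (s : {ffun 'I_m -> bool}).
Context (P : probability (X * R)%type R).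

Let atom (p : 'I_m * bool) : X * R := (x p.1, label b p.2).

Context (m_gt0 : (0 < m)%N) (xi01 : 0 <= xi <= 1).
Context (PE : forall f : X * R -> \bar R,
  measurable_fun [set: X * R] f -> (forall z, 0 <= f z)%E ->
  (\int[P]_z f z = \sum_p (cube_weight xi s p)%:E * f (atom p))%E).

Lemma cube_integrable_label : (\int[P]_z `|z.2|%:E < +oo)%E.
Proof.
rewrite PE; last 2 first.
- by apply/measurable_EFinP/measurableT_comp => //; exact: measurable_snd.
- by move=> z; rewrite lee_fin.
by under eq_bigr do rewrite -EFinM; rewrite sumEFin ltry.
Qed.

Lemma cube_absolute_risk (g : X -> R) : measurable_fun [set: X] g ->
  risk (@absolute_loss R) P g =
  (b * (1 - xi) + \sum_j m%:R^-1 * excess b xi (s j) (g (x j)))%:E.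
Proof.
move=> mg; rewrite /risk /absolute_loss PE; last 2 first.
- apply/measurable_EFinP/measurableT_comp => //.
  apply: measurable_funB; first exact: measurable_snd.
  by apply: measurableT_comp => //; exact: measurable_fst.
- by move=> z; rewrite lee_fin.
under eq_bigr do rewrite -EFinM.
by rewrite sumEFin -(cube_riskE b xi s (g \o x))//.
Qed.

Lemma cube_expected_risk (n : nat) (ghat : n.-tuple (X * R) -> X -> R) :
  is_estimator ghat ->
  expected_risk (@absolute_loss R) P ghat =
  (b * (1 - xi) + \sum_(t : n.-tuple ('I_m * bool))
    (\prod_(i < n) cube_weight xi s (tnth t i)) *
    \sum_j m%:R^-1 * excess b xi (s j) (ghat (map_tuple atom t) (x j)))%:E.
Proof.
move=> mghat.
have mg1 t : measurable_fun [set: X] (ghat t).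
  exact: (measurable_fun_pair2 t mghat).
have mg2 y : measurable_fun [set: n.-tuple (X * R)] (ghat^~ y).
  exact: (measurable_fun_pair1 y mghat).
have w0 p : 0 <= cube_weight xi s p by exact: cube_weight_ge0.
rewrite /expected_risk.
rewrite (power_probability_finite_support (cube_weight xi s) atom w0 P n PE).
- rewrite (eq_bigr (fun t => ((\prod_(i < n) cube_weight xi s (tnth t i)) *
    (b * (1 - xi) + \sum_j m%:R^-1 *
      excess b xi (s j) (ghat (map_tuple atom t) (x j))))%:E)); last first.
    by move=> t _; rewrite cube_absolute_risk.
  rewrite sumEFin; congr EFin.
  under eq_bigr do rewrite mulrDr.
  rewrite big_split/= -mulr_suml sum_prod_tuple sum_cube_weight//.
  by rewrite expr1n mul1r.
(* Measurability of the risk in the sample is read off its explicit finite formula. *)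
- under eq_fun do rewrite cube_absolute_risk//.
  apply/measurable_EFinP/measurable_funD => //; apply: measurable_sum => j.
  apply: measurable_funM => //; apply: measurable_funB => //.
  by apply: measurable_funD; apply: measurable_funM => //;
    apply: measurableT_comp => //; exact: measurable_funB.
- by move=> t; apply: integral_ge0 => z _; rewrite lee_fin normr_ge0.
Qed.

End cube_distribution.

(** Serves the case [d = 1], where the bound to reach is 0: a point mass on the graph of [g] gives
    [g] risk 0, and an expected risk is never negative. *)
Lemma dirac_lower_bound {R : realType} {disp : measure_display}
    {X : measurableType disp} (n : nat) (G : {fset {mfun X >-> R}})
    (g : {mfun X >-> R}) : g \in G ->
  exists P : probability (X * R)%type R,
    (\int[P]_z `|z.2|%:E < +oo)%E /\
    forall ghat : n.-tuple (X * R) -> X -> R,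
      (0 <= expected_risk (@absolute_loss R) P ghat -
        \big[Order.min/+oo]_(g <- G) risk (@absolute_loss R) P g)%E.
Proof.
move=> gG; exists (\d_(point, g point)); split => [|ghat].
  rewrite integral_dirac ?diracT ?mul1e ?ltry//.
  by apply/measurable_EFinP/measurableT_comp => //; exact: measurable_snd.
apply: adde_ge0.
  by apply: integral_ge0 => t _; apply: integral_ge0 => z _;
    rewrite lee_fin normr_ge0.
rewrite oppe_ge0; apply: (@bigmin_inf_seq _ _ _ _ _ g) => //.
rewrite /risk /absolute_loss integral_dirac ?diracT ?mul1e/= ?subrr ?normr0//.
apply/measurable_EFinP/measurableT_comp => //.
apply: measurable_funB; first exact: measurable_snd.
by apply: measurableT_comp => //; exact: measurable_fst.
Qed.

Theorem theorem8p13 (R : realType) (disp : measure_display)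
    (X : measurableType disp) (n d : nat) (b : R) :
  (1 <= n)%N -> (1 <= d)%N -> 0 < b ->
  contains_points X (trunc_log 2 d) ->
  exists G : {fset {mfun X >-> R}},
    [/\ #|` G| = d,
        forall g : {mfun X >-> R}, g \in G -> forall x : X, `|g x| <= b
      & forall ghat : n.-tuple (X * R) -> X -> R, is_estimator ghat ->
        exists P : probability (X * R)%type R,
          (\int[P]_z `|z.2|%:E < +oo)%E /\
          ((b / 4 * Num.sqrt (Num.min ((trunc_log 2 #|` G|)%:R / n%:R)
                                      (1 / 4)))%:E <=
           expected_risk (@absolute_loss R) P ghat -
           \big[Order.min/+oo]_(g <- G) risk (@absolute_loss R) P g)%E ].
Proof.
move=> n0 d0 b0; set m := trunc_log 2 d => -[x [_ sep]].
have /andP[md _] := @trunc_log_bounds 2 d isT d0.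
have [G [Gd Gb Gs]] := separated_points_class x b d b0 md sep.
exists G; split => // ghat mghat; rewrite Gd -/m.
have [m0|m0] := posnP m.
  have [g gG _] := Gs [ffun=> true].
  have [P [PY PG]] := dirac_lower_bound n G g gG.
  exists P; split => //; rewrite m0 mul0r min_l//.
  by rewrite sqrtr0 mulr0; exact: PG.
(* The bound q <= 1/4 yields xi <= 1/4, the bound q <= m/n yields xi^2 n <= m/4, and b xi / 2 is
   exactly the target (b/4) sqrt q. *)
set q := Num.min _ _; pose xi := Num.sqrt q / 2.
have nR0 : 0 < n%:R :> R by rewrite ltr0n.
have q0 : 0 <= q by rewrite le_min divr_ge0//=; lra.
have xi2 : xi ^+ 2 = q / 4 by rewrite exprMn sqr_sqrtr//; field.
have xi0 : 0 <= xi by rewrite divr_ge0// sqrtr_ge0.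
have xi4 : 0 <= xi <= 1 / 4.
  have q4 : q <= 1 / 4 by rewrite ge_min lexx orbT.
  by rewrite xi0/= leNgt; apply/negP => xi_gt; nra.
have xi1 : 0 <= xi <= 1 by rewrite xi0; lra.
have xin : xi ^+ 2 * n%:R <= m%:R / 4.
  have : q * n%:R <= m%:R by rewrite -ler_pdivlMr// ge_min lexx.
  by rewrite xi2; lra.
pose atom (p : 'I_m * bool) : X * R := (x p.1, label b p.2).
(* On samples of atoms the estimator is a map on index tuples; the hard target [s] depends on it. *)
have [s risk_ge] := assouad b xi n (fun t j => ghat (map_tuple atom t) (x j))
  m0 (ltW b0) xi4 xin.
have [P PE] := finite_support_probability (cube_weight xi s) atom
  (fun p => cube_weight_ge0 xi s p xi1) (sum_cube_weight xi s m0).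
exists P; split; first exact: (cube_integrable_label x b xi s P PE).
have [g gG gE] := Gs s.
(* The minimum over [G] is at most the risk of the vertex [g], and this upper bound suffices because
   the minimum is subtracted. *)
apply: (@le_trans _ _ (expected_risk (@absolute_loss R) P ghat -
  risk (@absolute_loss R) P g)%E); last first.
  by apply: leeB => //; exact: (@bigmin_inf_seq _ _ _ _ _ g).
have -> : risk (@absolute_loss R) P g = (b * (1 - xi))%:E.
  rewrite (cube_absolute_risk x b xi s P m0 PE)// big1 ?addr0// => j _.
  by rewrite gE excess_label ?mulr0// ltW.
rewrite (cube_expected_risk x b xi s P m0 xi1 PE)//.
rewrite -EFinB lee_fin addrAC subrr add0r (le_trans _ risk_ge)//.
by rewrite /xi; lra.
Qed.
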